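(* Let $K$ be a perfect field, $R$ a $K$-algebra, and $J$ an ideal of $R$. If $J$ and $R/J$ are both locally f.d.ss $K$-algebras, then $R$ is locally f.d.ss.
   Context: A field $K$ is perfect if every algebraic extension of $K$ is separable. All algebras are associative but not necessarily unital $K$-algebras; ideals are two-sided ring ideals that are also $K$-subspaces. A $K$-algebra $R$ is locally f.d.ss (locally finite dimensional semisimple) if every finite subset of $R$ is contained in a subalgebra of $R$ that is a finite dimensional semisimple $K$-algebra. *)

(* Defs.v *)
From HB Require Import structures.
From mathcomp Require Import all_boot all_order all_algebra all_field.
Set Implicit Arguments. Unset Strict Implicit. Unset Printing Implicit Defensive.
Import GRing.Theory.
Local Open Scope ring_scope.

(* A field K is perfect if every algebraic extension of K is separable.
   Every algebraic extension is the union of its finite subextensions, so this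
   is literally the statement that every finite field extension L/K
   (a [fieldExtType K]) is separable over K. *)
Definition perfect_field (K : fieldType) : Prop :=
  forall L : fieldExtType K, separable (1%VS : {vspace L}) fullv.

Record nalgType (K : fieldType) := NAlgType {
  nalg_sort :> lmodType K;
  nmul : nalg_sort -> nalg_sort -> nalg_sort;
  nmulA : associative nmul;
  nmulDl : left_distributive nmul +%R;
  nmulDr : right_distributive nmul +%R;
  nmulZl : forall (a : K) x y, nmul (a *: x) y = a *: nmul x y;
  nmulZr : forall (a : K) x y, nmul x (a *: y) = a *: nmul x y
}.
Arguments nmul {K} R x y : rename.

Section Defs.
Variables (K : fieldType) (R : nalgType K).

Definition is_subspace (S : R -> Prop) : Prop :=
  [/\ S 0, (forall x y, S x -> S y -> S (x + y)) &
      (forall (a : K) x, S x -> S (a *: x))].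

Definition is_subalg (S : R -> Prop) : Prop :=
  is_subspace S /\ (forall x y, S x -> S y -> S (nmul R x y)).

Definition is_ideal_in (A I : R -> Prop) : Prop :=
  [/\ is_subspace I, (forall x, I x -> A x),
      (forall a x, A a -> I x -> I (nmul R a x)) &
      (forall a x, A a -> I x -> I (nmul R x a))].

Definition is_ideal (I : R -> Prop) : Prop := is_ideal_in (fun _ => True) I.

Definition nprod (x : R) (s : seq R) : R := foldl (nmul R) x s.

Definition nilpotent_set (I : R -> Prop) : Prop :=
  exists n : nat, forall (x : R) (s : seq R),
    size s = n -> I x -> (forall y, y \in s -> I y) -> nprod x s = 0.

Definition in_span (s : seq R) (x : R) : Prop :=
  exists c : 'I_(size s) -> K, x = \sum_(i < size s) c i *: s`_i.

Definition fin_dim (S : R -> Prop) : Prop :=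
  exists s : seq R, forall x, S x <-> in_span s x.

(* S (a subalgebra) is semisimple: its (Wedderburn/Jacobson) radical is 0,
   i.e. S has no nonzero nilpotent two-sided ideal *)
Definition semisimple_sub (S : R -> Prop) : Prop :=
  forall I, is_ideal_in S I -> nilpotent_set I -> forall x, I x -> x = 0.

Definition fdss_subalg (S : R -> Prop) : Prop :=
  [/\ is_subalg S, fin_dim S & semisimple_sub S].

Definition locally_fdss_in (A : R -> Prop) : Prop :=
  forall s : seq R, (forall x, x \in s -> A x) ->
    exists S : R -> Prop,
      [/\ fdss_subalg S, (forall x, S x -> A x) & (forall x, x \in s -> S x)].

Definition locally_fdss : Prop := locally_fdss_in (fun _ => True).

End Defs.

Definition nalg_hom (K : fieldType) (R Q : nalgType K) (f : R -> Q) : Prop :=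
  [/\ forall x y, f (x + y) = f x + f y,
      forall (a : K) x, f (a *: x) = a *: f x &
      forall x y, f (nmul R x y) = nmul Q (f x) (f y)].

(* Main.v *)
Require Import Defs.
From HB Require Import structures.
From mathcomp Require Import all_boot all_order all_algebra all_field.
From Stdlib Require Import Classical.
Set Implicit Arguments.
Unset Strict Implicit.
Unset Printing Implicit Defensive.
Import GRing.Theory.
Local Open Scope ring_scope.

(** Let [S] be a finite-dimensional semisimple subalgebra of [R/J] containing
    the images of the given elements, and let [sigma : S -> R] be a linear lift.
    Finitely many elements of [J] generate a subalgebra [N], stable under
    [sigma S], modulo which [sigma] is multiplicative and hits the given
    elements. Embed [N] in a finite-dimensional semisimple subalgebra of [J],
    with unit [e]. Then [a |-> sigma a * e - e * sigma a] is a derivation of [S]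
    into the annihilator of [N] in [J], an [S]-bimodule through [sigma]. As [K]
    is perfect, [S] is separable and this derivation is inner, say the
    commutator with [w]; hence [q = e - w] commutes with [sigma S] and still
    acts as the identity on [N]. Let [T] be a finite-dimensional semisimple
    subalgebra of [J] containing [N], [q] and [sigma S * q]. For [k] large
    enough (Fitting), [q^k T q^k] is a semisimple subalgebra, stable under
    [sigma S] and containing [N], and [sigma S + q^k T q^k] is the required
    subalgebra.

    [S] is separable because [S (x) S^op] is semisimple: a nonzero ideal of it
    meets [Z(S) (x) Z(S)], whose elements become simultaneously diagonalizable
    over a splitting field, so it is not nil.

    Semisimplicity is used in the form "[x S x = 0] implies [x = 0]". *)

(** * Choices and subspaces *)

Lemma exists_argmin (T : Type) (P : T -> Prop) (f : T -> nat) :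
  (exists x, P x) -> exists2 x, P x & forall y, P y -> (f x <= f y)%N.
Proof.
case=> x; have [k] := ubnP (f x); elim: k x => // k IH x; rewrite ltnS => fx Px.
have [[y [Py lt_yx]]|nex] := classic (exists y, P y /\ (f y < f x)%N).
  exact: IH (leq_trans lt_yx fx) Py.
exists x => // y Py; rewrite leqNgt; apply/negP => lt_yx.
by apply: nex; exists y.
Qed.

Lemma exists_seq_image (T U : eqType) (P : T -> U -> Prop) (s : seq T) :
    (forall x, x \in s -> exists y, P x y) ->
  exists t : seq U, (forall y, y \in t -> exists x, P x y) /\
    forall x, x \in s -> exists2 y, y \in t & P x y.
Proof.
elim: s => [|x s IH] sP; first by exists [::].
have [y Pxy] := sP x (mem_head x s).
have [|t [tP st]] := IH; first by move=> z zs; apply: sP; rewrite inE zs orbT.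
exists (y :: t); split=> z; rewrite inE => /orP[/eqP->|].
- by exists x.
- exact: tP.
- by exists y; rewrite ?mem_head.
by case/st=> w tw Pzw; exists w; rewrite // inE tw orbT.
Qed.

Section Subspaces.
Variables (K : fieldType) (V : vectType K).

Lemma exists_minimal_vspace (P : {vspace V} -> Prop) :
    (exists U, P U) ->
  exists2 U, P U & forall W, P W -> (W <= U)%VS -> W = U.
Proof.
move=> /(exists_argmin (fun U : {vspace V} => \dim U))[U PU minU].
by exists U => // W PW sWU; apply/eqP; rewrite eqEdim sWU minU.
Qed.

Lemma vspace_of_pred (P : V -> Prop) :
    P 0 -> (forall k x y, P x -> P y -> P (k *: x + y)) ->
  exists U : {vspace V}, forall x, x \in U <-> P x.
Proof.
move=> P0 PP; pose inside (U : {vspace V}) := forall x, x \in U -> P x.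
have [|U UP maxU] :=
    @exists_argmin _ inside (fun U => (\dim {:V} - \dim U)%N).
  by exists 0%VS => x; rewrite memv0 => /eqP->.
exists U => x; split=> [/UP //|Px].
have UxP : inside (<[x]> + U)%VS.
  by move=> _ /memv_addP[_ /vlineP[k ->] [u /UP Pu ->]]; apply: PP.
have /eqP-> : U == (<[x]> + U)%VS.
  rewrite eqEdim addvSr -(leq_sub2lE (m := \dim {:V})) ?maxU //.
  exact: dimvS (subvf _).
by apply: subvP (addvSl _ _) _ (memv_line x).
Qed.

End Subspaces.

(** * Finite-dimensional semiprime algebras *)

Local Notation bilinear_map f := (bilinear_for
  (GRing.Scale.Law.clone _ _ *:%R _) (GRing.Scale.Law.clone _ _ *:%R _) f).

(* [applyr mul] is the product of the opposite algebra. *)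
Section OppositeProduct.
Variables (K : fieldType) (V : lmodType K) (mul : {bilinear V -> V -> V}).

Fact applyr_is_bilinear : bilinear_map (applyr mul).
Proof. by split=> a k x y; [exact: (linearPr mul) | exact: (linearPl mul)]. Qed.

HB.instance Definition _ :=
  bilinear_isBilinear.Build K V V V _ _ (applyr mul) applyr_is_bilinear.

Lemma applyr_associative : associative mul -> associative (applyr mul).
Proof. by move=> mulA x y z; rewrite !applyrE mulA. Qed.

End OppositeProduct.

Definition semiprime (V : zmodType) (mul : V -> V -> V) : Prop :=
  forall x, (forall t, mul (mul x t) x = 0) -> x = 0.

Section Ideals.
Variables (K : fieldType) (V : vectType K) (mul : V -> V -> V).
Implicit Type I : {vspace V}.

Definition left_ideal I : Prop := forall a x, x \in I -> mul a x \in I.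
Definition right_ideal I : Prop := forall a x, x \in I -> mul x a \in I.

End Ideals.

Section SemiprimeAlgebra.
Variables (K : fieldType) (V : vectType K) (mul : {bilinear V -> V -> V}).
Hypothesis mulA : associative mul.
Local Notation "x ** y" := (mul x y) (at level 40, left associativity).

(* If [x V x = 0], then the [y] with [x V y = 0] and [y V z = 0] whenever
   [x V z = 0] form an ideal [I] containing [x], with [I V I = 0]. *)
Lemma semiprime_of_ideals :
    (forall I : {vspace V}, left_ideal mul I -> right_ideal mul I ->
      (forall x y t, x \in I -> y \in I -> x ** t ** y = 0) -> I = 0%VS) ->
  semiprime mul.
Proof.
move=> ideal0 x xtx.
pose rann z := forall t, x ** t ** z = 0.
have [|k y z [y1 y2] [z1 z2]|I IP] := @vspace_of_pred _ _
    (fun y => rann y /\ forall t z, rann z -> y ** t ** z = 0).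
- by split=> [t|t z _]; rewrite ?linear0r ?linear0l.
- split=> [t|t w w0]; first by rewrite linearPr y1 z1 scaler0 addr0.
  by rewrite !linearPl y2 // z2 // scaler0 addr0.
have idlI : left_ideal mul I.
  move=> a y /IP[y1 y2]; apply/IP; split=> [t|t z z0].
    by rewrite mulA -(mulA x) y1.
  by rewrite -!mulA (mulA y) y2 ?linear0r.
have idrI : right_ideal mul I.
  move=> a y /IP[y1 y2]; apply/IP; split=> [t|t z z0].
    by rewrite mulA y1 linear0l.
  by rewrite -(mulA y) y2.
have Ix : x \in I by apply/IP.
apply/eqP; rewrite -memv0 -(ideal0 I) // => y z t /IP[_ y2] /IP[z1 _].
exact: y2.
Qed.

Hypothesis sp : semiprime mul.

Lemma semiprime_neq0 x : x != 0 -> exists t, x ** t ** x != 0.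
Proof.
move=> nzx; apply: NNPP => nex; case/eqP: nzx; apply: sp => t.
by apply/eqP; apply: contraT => nz; case: nex; exists t.
Qed.

(* Brauer: a minimal left ideal [L] contains an [a] with [L a <> 0]; then
   [y |-> y a] is a bijection of [L], and the preimage of [a] is idempotent. *)
Lemma minimal_left_ideal_idempotent (L : {vspace V}) :
    left_ideal mul L -> L != 0%VS ->
    (forall M, left_ideal mul M -> M != 0%VS -> (M <= L)%VS -> M = L) ->
  exists e, [/\ e \in L, e != 0 & e ** e = e].
Proof.
move=> idL; rewrite -vpick0; set x := vpick L => nzx minL.
have Lx : x \in L by apply: memv_pick.
have [t nz_xtx] := semiprime_neq0 nzx.
pose a := t ** x; have La : a \in L by apply: idL.
have nz_xa : x ** a != 0 by rewrite /a mulA.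
pose ra : 'End(V) := linfun (applyr mul a).
have raE y : ra y = y ** a by rewrite lfunE.
have imL : (ra @: L)%VS = L.
  apply: minL => [b _ /memv_imgP[y Ly ->]||].
  - by rewrite raE mulA -raE memv_img ?idL.
  - apply: contraNneq nz_xa => im0.
    by rewrite -memv0 -im0 -raE memv_img.
  - by apply/subvP=> _ /memv_imgP[y Ly ->]; rewrite raE idL.
have kerL : (L :&: lker ra)%VS = 0%VS.
  apply: contraNeq nz_xa => nzker; rewrite -raE -memv_ker.
  suff kerE : (L :&: lker ra)%VS = L.
    by have := Lx; rewrite -{1}kerE => /memv_capP[].
  apply: minL nzker (capvSl _ _) => b y /memv_capP[Ly].
  rewrite memv_ker memv_cap idL // memv_ker !raE -mulA => /eqP->.
  by rewrite linear0r eqxx.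
have : a \in (ra @: L)%VS by rewrite imL.
case/memv_imgP=> e Le; rewrite raE => ae; exists e; split=> //.
  by apply: contraNneq nz_xa => e0; rewrite ae e0 linear0l linear0r.
apply/eqP; rewrite -subr_eq0 -memv0 -kerL memv_cap memvB ?idL //=.
by rewrite memv_ker raE linearBl -mulA -ae -ae subrr.
Qed.

Lemma left_ideal_idempotent (L : {vspace V}) :
    left_ideal mul L -> L != 0%VS ->
  exists e, [/\ e \in L, e != 0 & e ** e = e].
Proof.
move=> idL nzL; have [|M [idM nzM sML] minM] := @exists_minimal_vspace _ _
    (fun M : {vspace V} => [/\ left_ideal mul M, M != 0%VS & (M <= L)%VS]).
  by exists L.
have [|e [Me nze ee]] := minimal_left_ideal_idempotent idM nzM.
  by move=> W *; apply: minM => //; split=> //; apply: subv_trans sML.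
by exists e; split=> //; apply: subvP Me.
Qed.

(* Take an idempotent [e] of [L] whose left annihilator in [L] is minimal: an
   idempotent [f] of this annihilator would yield the better [e + f - e f]. *)
Lemma left_ideal_unit (L : {vspace V}) : left_ideal mul L ->
  exists2 e, e \in L & forall x, x \in L -> x ** e = x.
Proof.
move=> idL; pose ann e : {vspace V} := (L :&: lker (linfun (applyr mul e)))%VS.
have annP e x : reflect (x \in L /\ x ** e = 0) (x \in ann e).
  rewrite memv_cap memv_ker lfunE /=.
  by apply: (iffP andP) => -[Lx /eqP].
have [|e [Le ee] min_e] := @exists_argmin _
    (fun e => e \in L /\ e ** e = e) (fun e => \dim (ann e)).
  by exists 0; rewrite mem0v linear0l.
have [ann0|nz_ann] := eqVneq (ann e) 0%VS.
  exists e => // x Lx; apply/esym/eqP; rewrite -subr_eq0 -memv0 -ann0.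
  by apply/annP; rewrite memvB ?idL // linearBl -mulA ee subrr.
have id_ann : left_ideal mul (ann e).
  by move=> b y /annP[Ly ye]; apply/annP; rewrite -mulA ye linear0r idL.
have [f [/annP[Lf fe] nzf ff]] := left_ideal_idempotent id_ann nz_ann.
pose g := e + f - e ** f.
have ge : g ** e = e.
  by rewrite linearBl linearDl ee fe -mulA fe linear0r subr0 addr0.
have fg : f ** g = f.
  by rewrite linearBr linearDr fe ff mulA fe linear0l subr0 add0r.
have eg : e ** g = e by rewrite linearBr linearDr ee mulA ee addrK.
have gg : g ** g = g by rewrite {1}/g linearBl linearDl -mulA fg eg.
have Lg : g \in L by rewrite memvB ?memvD ?idL.
have s_ann : (ann g <= ann e)%VS.
  apply/subvP=> y /annP[Ly yg]; apply/annP; split=> //.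
  by rewrite -ge mulA yg linear0l.
have /eqP ann_eq : ann g == ann e by rewrite eqEdim s_ann min_e.
have /annP[_] : f \in ann g by rewrite ann_eq; apply/annP.
by rewrite fg; move/eqP: nzf.
Qed.

End SemiprimeAlgebra.

Section TwoSidedIdeals.
Variables (K : fieldType) (V : vectType K) (mul : {bilinear V -> V -> V}).
Hypotheses (mulA : associative mul) (sp : semiprime mul).
Local Notation "x ** y" := (mul x y) (at level 40, left associativity).

Lemma semiprime_applyr : semiprime (applyr mul).
Proof. by move=> x x0; apply: sp => t; rewrite -mulA; apply: x0. Qed.

Lemma ideal_central_unit (I : {vspace V}) :
    left_ideal mul I -> right_ideal mul I ->
  exists e, [/\ e \in I, forall x, x \in I -> e ** x = x /\ x ** e = x
    & forall a, a ** e = e ** a].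
Proof.
move=> idl idr; have [e Ie eR] := left_ideal_unit mulA sp idl.
have [e' Ie' eL] :=
  left_ideal_unit (applyr_associative mulA) semiprime_applyr idr.
have {}eL x : x \in I -> e' ** x = x by apply: eL.
have ee' : e' = e by rewrite -[LHS](eR e' Ie') eL.
rewrite {e'}ee' in eL Ie'.
exists e; split=> // [x Ix|a]; first by rewrite eL ?eR.
by rewrite -[LHS]eL ?idl // mulA eR ?idr.
Qed.

Lemma semiprime_unit : exists u, forall x, u ** x = x /\ x ** u = x.
Proof.
have [||u [_ uP _]] := @ideal_central_unit fullv; try by move=> *; apply: memvf.
by exists u => x; apply: uP; apply: memvf.
Qed.

End TwoSidedIdeals.

(** * Separable polynomials over a perfect field *)

Lemma irreducible_factor (K : fieldType) (p : {poly K}) : (1 < size p)%N ->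
  exists2 q, irreducible_poly q & q %| p.
Proof.
move=> p1; have [|q [q1 qp] min_q] := @exists_argmin {poly K}
    (fun q => (1 < size q)%N /\ q %| p) (fun q => size q).
  by exists p.
exists q => //; split=> // r r1 rq.
have nzq : q != 0 by rewrite -size_poly_gt0 ltnW.
have r_gt1 : (1 < size r)%N.
  rewrite ltn_neqAle eq_sym r1 size_poly_gt0.
  by apply: contraNneq nzq => r0; rewrite r0 dvd0p in rq.
rewrite -dvdp_size_eqp // eqn_leq dvdp_leq //=.
by apply: min_q; split=> //; apply: dvdp_trans qp.
Qed.

Lemma splitting_extension (K : fieldType) (p : {poly K}) : p != 0 ->
  exists (L : fieldType) (f : {rmorphism K -> L}) (c : L) (rs : seq L),
    map_poly f p = c *: \prod_(r <- rs) ('X - r%:P).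
Proof.
have [k] := ubnP (size p).
elim: k K p => // k IH K p; rewrite ltnS => szp nzp.
have [p1|/size1_polyC ->] := ltnP 1 (size p); last first.
  exists K, (idfun : {rmorphism K -> K}), p`_0, [::].
  by rewrite big_nil map_polyC /= alg_polyC.
have [q irr_q qp] := irreducible_factor p1.
have [L _ [z qz0 _]] := irredp_FAdjoin irr_q.
have /factor_theorem[p' Dp] : root (map_poly (in_alg L) p) z.
  by have /dvdpP[s ->] := qp; rewrite rmorphM rootM qz0 orbT.
have nzp' : p' != 0.
  apply: contraNneq nzp => p'0.
  by rewrite -(map_poly_eq0 (in_alg L)) Dp p'0 mul0r.
have szp' : (size p' < k)%N.
  apply: leq_trans szp; rewrite -(size_map_poly (in_alg L)) Dp.
  by rewrite size_Mmonic ?monicXsubC // size_XsubC addn2.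
have [M [g [c [rs Dp']]]] := IH L p' szp' nzp'.
exists M, (g \o in_alg L : {rmorphism K -> M}), c, (g z :: rs).
rewrite map_poly_comp Dp rmorphM /= Dp' rmorphB /= map_polyX map_polyC /=.
by rewrite big_cons -scalerAl mulrC.
Qed.

Section PerfectField.
Variables (K : fieldType) (perfK : perfect_field K).
Implicit Type p : {poly K}.

Lemma perfect_irreducible_deriv_neq0 p : irreducible_poly p -> p^`() != 0.
Proof.
move=> irr_p; have [L _ [z pz0 _]] := irredp_FAdjoin irr_p.
have /separableP/(_ z (memvf z)) := perfK L.
rewrite separable_nz_der; apply: contraNneq => p'0.
have /polyOver1P[q Dq] := minPolyOver 1 z.
have qp : q %| p.
  by rewrite -(dvdp_map (in_alg L)) -Dq minPoly_dvdp // alg_polyOver.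
have q1 : size q != 1%N.
  by rewrite -(size_map_poly (in_alg L)) -Dq size_minPoly.
have /eqpP[[a b] /= /andP[nza nzb] eqab] := irr_p.2 q q1 qp.
have /eqP := congr1 (@deriv K) eqab; rewrite !derivZ p'0 scaler0 scaler_eq0.
by rewrite (negPf nza) /= => /eqP q'0; rewrite Dq deriv_map q'0 rmorph0.
Qed.

Lemma perfect_squarefree_separable p :
    (forall g : {poly K}, size g != 1%N -> ~~ (g ^+ 2 %| p)) ->
  separable_poly p.
Proof.
move=> /poly_square_freeP sqf; apply/separable_polyP; split=> // u up u1.
have [g irr_g gu] := irreducible_factor u1.
have /dvdpP[q Dq] := gu; apply/negP => /eqP u'0.
have co_gq : coprimep g q by apply: sqf; rewrite mulrC -Dq.
have gg' : g %| g^`().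
  rewrite -(Gauss_dvdpr _ co_gq) -(dvdp_addr _ (dvdp_mull q^`() (dvdpp g))).
  by rewrite -derivM -Dq u'0 dvdp0.
have := dvdp_leq (perfect_irreducible_deriv_neq0 irr_g) gg'.
by rewrite leqNgt lt_size_deriv ?irredp_neq0.
Qed.

End PerfectField.

(** * Multiplication matrices *)

Lemma eq_mulrV (K : fieldType) m p (A B : 'M[K]_(m, p)) :
  (forall x : 'rV_m, x *m A = x *m B) -> A = B.
Proof. by move=> eqAB; apply/row_matrixP => i; rewrite !rowE eqAB. Qed.

Definition lmulmx (K : fieldType) n (mul : 'rV[K]_n -> 'rV[K]_n -> 'rV[K]_n) a :
  'M[K]_n := lin1_mx (mul a).

Definition rmulmx (K : fieldType) n (mul : 'rV[K]_n -> 'rV[K]_n -> 'rV[K]_n) a :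
  'M[K]_n := lmulmx (applyr mul) a.

Section MultiplicationMatrices.
Variables (K : fieldType) (n : nat).
Variable mul : {bilinear 'rV[K]_n -> 'rV[K]_n -> 'rV[K]_n}.
Local Notation "x ** y" := (mul x y) (at level 40, left associativity).

Lemma mul_lmulmx a x : x *m lmulmx mul a = a ** x.
Proof. exact: mul_rV_lin1. Qed.

Lemma mul_rmulmx a x : x *m rmulmx mul a = x ** a.
Proof. exact: (mul_rV_lin1 (applyr mul a)). Qed.

Fact lmulmx_is_linear : linear (lmulmx mul).
Proof.
move=> k a b; apply: eq_mulrV => x.
by rewrite mulmxDr -scalemxAr !mul_lmulmx linearPl.
Qed.

HB.instance Definition _ :=
  GRing.isLinear.Build K 'rV[K]_n 'M[K]_n _ (lmulmx mul) lmulmx_is_linear.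

Lemma lrmulmx1 u : (forall x, u ** x = x /\ x ** u = x) ->
  lmulmx mul u = 1%:M /\ rmulmx mul u = 1%:M.
Proof.
by move=> uP; split; apply: eq_mulrV => x;
  rewrite ?(mul_lmulmx, mul_rmulmx) mulmx1; case: (uP x).
Qed.

Hypothesis mulA : associative mul.

Lemma lmulmxM a b : lmulmx mul (a ** b) = lmulmx mul b *m lmulmx mul a.
Proof. by apply: eq_mulrV => x; rewrite mulmxA !mul_lmulmx mulA. Qed.

Definition centroid (A : 'M[K]_n) : Prop :=
  forall a, comm_mx A (lmulmx mul a) /\ comm_mx A (rmulmx mul a).

Lemma centroid_lmulmx z :
  (forall a, a ** z = z ** a) -> centroid (lmulmx mul z).
Proof.
move=> zC a; split; first by rewrite /comm_mx -!lmulmxM zC.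
by apply: eq_mulrV => x; rewrite !mulmxA !(mul_lmulmx, mul_rmulmx) mulA.
Qed.

Lemma semiprime_centroid_reduced A :
  semiprime mul -> centroid A -> A *m A = 0 -> A = 0.
Proof.
move=> sp cA AA0; have mulAx x t : (x *m A) ** t = (x ** t) *m A.
  by rewrite -!mul_rmulmx -!mulmxA (cA t).2.
have mulxA x t : x ** (t *m A) = (x ** t) *m A.
  by rewrite -!mul_lmulmx -!mulmxA (cA x).1.
apply: eq_mulrV => x; rewrite mulmx0; apply: sp => t.
by rewrite mulxA !mulAx -mulmxA AA0 mulmx0.
Qed.

End MultiplicationMatrices.

Lemma semiprime_centroid_mxminpoly_separable (K : fieldType) n
    (mul : {bilinear 'rV[K]_n.+1 -> 'rV[K]_n.+1 -> 'rV[K]_n.+1})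
    (A : 'M[K]_n.+1) :
  perfect_field K -> semiprime mul -> centroid mul A ->
  separable_poly (mxminpoly A).
Proof.
move=> perfK sp cA; apply: perfect_squarefree_separable => // g g1.
apply/negP=> /dvdpP[q Dq].
have centroid_horner h : centroid mul (horner_mx A h).
  by move=> a; have [cl cr] := cA a; split; apply: comm_horner_mx.
have qg0 : horner_mx A (q * g) = 0.
  apply: (semiprime_centroid_reduced sp) => //; rewrite mulmxE -rmorphM.
  have -> : q * g * (q * g) = q * mxminpoly A.
    by rewrite Dq expr2 !mulrA (mulrAC q g q).
  by rewrite rmorphM /= mx_root_minpoly mulr0.
have nzqg : q * g != 0.
  have : mxminpoly A != 0 by rewrite monic_neq0 ?mxminpoly_monic.
  by apply: contraNneq => qg; rewrite Dq expr2 mulrA qg mul0r.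
have := mxminpoly_min qg0; rewrite Dq expr2 mulrA -[X in _ %| X]mulr1.
by rewrite dvdp_mul2l // dvdp1 (negPf g1).
Qed.

Section Sandwich.
Variable K : fieldType.

Definition sandwich m n r (A : 'I_r -> 'M[K]_m) (B : 'I_r -> 'M[K]_n)
    (Q : 'M[K]_(m, n)) : 'M[K]_(m, n) :=
  \sum_k (A k)^T *m Q *m B k.

Lemma commuting_separable_codiagonalizable (L : fieldType)
    (f : {rmorphism K -> L}) n r (A : 'I_r -> 'M[K]_n.+1) (rs : seq L) :
    (forall i j, comm_mx (A i) (A j)) ->
    (forall i, separable_poly (mxminpoly (A i))) ->
    (forall i, map_poly f (mxminpoly (A i)) %| \prod_(x <- rs) ('X - x%:P)) ->
  exists2 P, P \in unitmx & exists d : 'I_r -> 'rV[L]_n.+1,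
    forall i, map_mx f (A i) *m P = P *m diag_mx (d i).
Proof.
move=> cA sepA splitA; pose As := [seq map_mx f (A i) | i <- enum 'I_r].
have /codiagonalizableP[P Pu /allP PA] :
    {in As &, forall B C, comm_mx B C} /\
    (forall B, B \in As -> diagonalizable B).
  split=> [_ _ /mapP[i _ ->] /mapP[j _ ->]|_ /mapP[i _ ->]].
    by rewrite /comm_mx -!map_mxM cA.
  apply/diagonalizableP; rewrite mxminpoly_map.
  have [m eqm] := dvdp_prod_XsubC (splitA i).
  exists (mask m rs); last by rewrite (eqp_dvdl _ eqm).
  by rewrite -separable_prod_XsubC -(eqp_separable eqm) separable_map.
exists (invmx P); first by rewrite unitmx_inv.
have /fin_all_exists[d dP] : forall i, exists d : 'rV[L]_n.+1,
    map_mx f (A i) = conjmx (invmx P) (diag_mx d).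
  move=> i; apply/(diagonalizable_forLR Pu); apply: PA.
  by apply: map_f; rewrite mem_enum.
by exists d => i; rewrite dP conjumx ?unitmx_inv // invmxK mulmxK // mulmxV.
Qed.

Lemma sandwich_diagonal (L : fieldType) (f : {rmorphism K -> L}) m n r
    (A : 'I_r -> 'M[K]_m) (B : 'I_r -> 'M[K]_n) (G : 'M[L]_m) (H : 'M[L]_n)
    (d : 'I_r -> 'rV[L]_m) (e : 'I_r -> 'rV[L]_n) (Q : 'M[K]_(m, n)) i j :
    (forall k, map_mx f (A k) *m G = G *m diag_mx (d k)) ->
    (forall k, map_mx f (B k) *m H = H *m diag_mx (e k)) ->
  (G^T *m map_mx f (sandwich A B Q) *m H) i j
    = (\sum_k d k 0 i * e k 0 j) * (G^T *m map_mx f Q *m H) i j.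
Proof.
move=> AG BH; rewrite map_mx_sum mulmx_sumr mulmx_suml summxE mulr_suml.
apply: eq_bigr => k _; rewrite !map_mxM -map_trmx !mulmxA -trmx_mul AG.
rewrite trmx_mul tr_diag_mx -!mulmxA BH !mulmxA.
by rewrite mul_mx_diag mxE -!mulmxA mul_diag_mx mxE mulrAC.
Qed.

Lemma separable_sandwich_reduced m n r
    (A : 'I_r -> 'M[K]_m.+1) (B : 'I_r -> 'M[K]_n.+1) Q :
    (forall i j, comm_mx (A i) (A j)) -> (forall i j, comm_mx (B i) (B j)) ->
    (forall i, separable_poly (mxminpoly (A i))) ->
    (forall i, separable_poly (mxminpoly (B i))) ->
  sandwich A B (sandwich A B Q) = 0 -> sandwich A B Q = 0.
Proof.
move=> cA cB sepA sepB ssQ0.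
pose p := (\prod_i mxminpoly (A i)) * (\prod_i mxminpoly (B i)).
have nzp : p != 0.
  rewrite mulf_neq0 // prodf_seq_neq0; apply/allP => i _ /=;
  by rewrite monic_neq0 ?mxminpoly_monic.
have [L [f [c [rs Dp]]]] := splitting_extension nzp.
have nzc : c != 0.
  by apply: contraNneq nzp => c0; rewrite -(map_poly_eq0 f) Dp c0 scale0r.
have split q : q %| p -> map_poly f q %| \prod_(x <- rs) ('X - x%:P).
  by rewrite -(dvdp_map f) Dp dvdpZr.
have [i|G Gu [d AG]] :=
    commuting_separable_codiagonalizable (f := f) (rs := rs) cA sepA.
  by apply: split; rewrite /p (bigD1 i) //= -mulrA dvdp_mulIl.
have [i|H Hu [e BH]] :=
    commuting_separable_codiagonalizable (f := f) (rs := rs) cB sepB.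
  by apply: split; rewrite /p mulrC (bigD1 i) //= -mulrA dvdp_mulIl.
have conj0 : G^T *m map_mx f (sandwich A B Q) *m H = 0.
  apply/matrixP => i j; rewrite [RHS]mxE; apply/eqP; rewrite -sqrf_eq0 expr2.
  rewrite {1}(sandwich_diagonal _ _ _ AG BH) mulrAC.
  rewrite -(sandwich_diagonal _ _ _ AG BH) ssQ0 map_mx0 mulmx0 mul0mx.
  by rewrite mxE mul0r.
apply/eqP; rewrite -(map_mx_eq0 f); apply/eqP.
have GTu : G^T \in unitmx by rewrite unitmx_tr.
rewrite -[map_mx f _](mulKmx GTu).
by rewrite -[_ *m map_mx f _](mulmxK Hu) conj0 mul0mx mulmx0.
Qed.

End Sandwich.

(** * Tensor products *)

(* The tensor product of ['rV_m] and ['rV_n] is ['M_(m, n)]. *)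
Local Notation "a *t b" := (a^T *m b)
  (at level 40, left associativity, only parsing) : ring_scope.

Section TensorLift.
Variables (K : fieldType) (m n : nat).
Implicit Types (a : 'rV[K]_m) (b : 'rV[K]_n) (P : 'M[K]_(m, n)).

Lemma tensor_ind (C : 'M[K]_(m, n) -> Prop) :
    (forall k P Q, C P -> C Q -> C (k *: P + Q)) ->
    (forall a b, C (a *t b)) ->
  forall P, C P.
Proof.
move=> CP Cpure P; have C0 : C 0 by have := Cpure 0 0; rewrite mulmx0.
have CD Q Q' : C Q -> C Q' -> C (Q + Q') by rewrite -{2}[Q]scale1r; apply: CP.
rewrite [P]matrix_sum_delta; elim/big_ind: _ => // i _.
elim/big_ind: _ => // j _; rewrite -[_ *: _]addr0; apply: CP => //.
by have := Cpure 'e_i 'e_j; rewrite trmx_delta mul_delta_mx.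
Qed.

Section Codomain.
Variable U : lmodType K.
Implicit Type B : 'rV[K]_m -> 'rV[K]_n -> U.

Definition tensor_lift B P : U := \sum_i \sum_j P i j *: B 'e_i 'e_j.

Fact tensor_lift_is_linear B : linear (tensor_lift B).
Proof.
move=> k P Q; rewrite scaler_sumr -big_split; apply: eq_bigr => i _ /=.
rewrite scaler_sumr -big_split; apply: eq_bigr => j _ /=.
by rewrite !mxE scalerDl scalerA.
Qed.

HB.instance Definition _ B := GRing.isLinear.Build K 'M[K]_(m, n) U _
  (tensor_lift B) (tensor_lift_is_linear B).

Lemma tensor_liftE B a b : bilinear_map B -> tensor_lift B (a *t b) = B a b.
Proof.
move=> bilB; pose C : {bilinear 'rV[K]_m -> 'rV[K]_n -> U} :=
  HB.pack B (bilinear_isBilinear.Build _ _ _ _ _ _ B bilB).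
rewrite -[RHS]/(C a b) {2}[a]row_sum_delta linear_sumlz.
apply: eq_bigr => i _; rewrite {2}[b]row_sum_delta linear_sumr.
apply: eq_bigr => j _.
by rewrite linearZl_LR linearZr_LR scalerA mxE big_ord1 mxE.
Qed.

Lemma eq_tensor_lift B B' :
  (forall a b, B a b = B' a b) -> tensor_lift B =1 tensor_lift B'.
Proof.
by move=> eqB P; apply: eq_bigr => i _; apply: eq_bigr => j _; rewrite eqB.
Qed.

Lemma tensor_lift_linear_fun k B B' P :
  tensor_lift (fun a b => k *: B a b + B' a b) P
    = k *: tensor_lift B P + tensor_lift B' P.
Proof.
rewrite scaler_sumr -big_split; apply: eq_bigr => i _ /=.
rewrite scaler_sumr -big_split; apply: eq_bigr => j _ /=.
by rewrite scalerDr !scalerA mulrC.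
Qed.

Lemma tensor_lift_mulmx B (A : 'M_m) (C : 'M_n) P : bilinear_map B ->
  tensor_lift B (A^T *m P *m C)
    = tensor_lift (fun a b => B (a *m A) (b *m C)) P.
Proof.
move=> bilB; elim/tensor_ind: P => [k P Q IHP IHQ|a b].
  by rewrite mulmxDr mulmxDl -scalemxAr -scalemxAl !linearP /= IHP IHQ.
rewrite !mulmxA -trmx_mul -mulmxA !tensor_liftE //.
by split=> c k x y /=; rewrite mulmxDl -scalemxAl ?bilB.1 ?bilB.2.
Qed.

End Codomain.

Lemma linear_tensor_lift (U W : lmodType K) (f : {linear U -> W}) B P :
  f (tensor_lift B P) = tensor_lift (fun a b => f (B a b)) P.
Proof.
rewrite linear_sum; apply: eq_bigr => i _; rewrite linear_sum.
by apply: eq_bigr => j _; rewrite linearZ.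
Qed.

Lemma linearl_tensor_lift (U U' W : lmodType K)
    (f : {bilinear U -> U' -> W}) B P z :
  f (tensor_lift B P) z = tensor_lift (fun a b => f (B a b) z) P.
Proof. exact: (linear_tensor_lift (applyr f z)). Qed.

End TensorLift.

Definition tmul (K : fieldType) m n (mulV : 'rV[K]_m -> 'rV[K]_m -> 'rV[K]_m)
    (mulW : 'rV[K]_n -> 'rV[K]_n -> 'rV[K]_n) (P Q : 'M[K]_(m, n)) :
    'M[K]_(m, n) :=
  tensor_lift (fun a b => (lmulmx mulV a)^T *m Q *m lmulmx mulW b) P.

Section TensorAlgebra.
Variables (K : fieldType) (m n : nat).
Variables (mulV : {bilinear 'rV[K]_m -> 'rV[K]_m -> 'rV[K]_m}).
Variables (mulW : {bilinear 'rV[K]_n -> 'rV[K]_n -> 'rV[K]_n}).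
Local Notation "P ** Q" := (tmul mulV mulW P Q)
  (at level 40, left associativity).

Fact tmul_is_bilinear : bilinear_map (tmul mulV mulW).
Proof.
split=> [Q|P] k X Y /=; first exact: linearP.
rewrite /tmul -tensor_lift_linear_fun; apply: eq_tensor_lift => a b.
by rewrite mulmxDr mulmxDl -scalemxAr -scalemxAl.
Qed.

HB.instance Definition _ := bilinear_isBilinear.Build K
  'M[K]_(m, n) 'M[K]_(m, n) 'M[K]_(m, n) _ _ (tmul mulV mulW) tmul_is_bilinear.

Lemma tmul_tensorl a b Q :
  (a *t b) ** Q = (lmulmx mulV a)^T *m Q *m lmulmx mulW b.
Proof.
rewrite /tmul tensor_liftE //; split=> [d|c] k x y /=.
  by rewrite !linearP !mulmxDl /= -!scalemxAl.
by rewrite linearP mulmxDr -scalemxAr.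
Qed.

Lemma tmul_tensorr P c d :
  P ** (c *t d) = (rmulmx mulV c)^T *m P *m rmulmx mulW d.
Proof.
elim/tensor_ind: P => [k P Q IHP IHQ|a b].
  by rewrite linearPl /= IHP IHQ mulmxDr mulmxDl -scalemxAr -scalemxAl.
rewrite tmul_tensorl !mulmxA -!trmx_mul -!mulmxA.
by rewrite !(mul_lmulmx, mul_rmulmx).
Qed.

Lemma tmul_tensor a b c d : (a *t b) ** (c *t d) = mulV a c *t mulW b d.
Proof. by rewrite tmul_tensorl !mulmxA -trmx_mul -mulmxA !mul_lmulmx. Qed.

Hypotheses (mulVA : associative mulV) (mulWA : associative mulW).

Lemma tmulA : associative (tmul mulV mulW).
Proof.
move=> P Q X; elim/tensor_ind: P => [k P P' IHP IHP'|a b].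
  by rewrite !linearPl /= IHP IHP'.
elim/tensor_ind: Q => [k Q Q' IHQ IHQ'|c d].
  by rewrite [in LHS]linearPl !linearPr linearPl /= IHQ IHQ'.
by rewrite tmul_tensor !tmul_tensorl !lmulmxM // trmx_mul -!mulmxA.
Qed.

End TensorAlgebra.

Section CommutingTensors.
Variables (K : fieldType) (m n : nat).
Variable mul : {bilinear 'rV[K]_m -> 'rV[K]_m -> 'rV[K]_m}.
Implicit Types (y : 'M[K]_(m, n)) (U W : {vspace 'M[K]_(m, n)}).

Definition mul_stable U : Prop := forall a y, y \in U ->
  (lmulmx mul a)^T *m y \in U /\ (rmulmx mul a)^T *m y \in U.

Definition commuting_tensor y : Prop :=
  forall a, (lmulmx mul a)^T *m y = (rmulmx mul a)^T *m y.

Hypotheses (mulA : associative mul) (sp : semiprime mul).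

(* On a minimal stable subspace some [col j] is injective, and its range is an
   ideal: take the preimage of the unit of this ideal. *)
Lemma minimal_stable_commuting_tensor U :
    mul_stable U -> U != 0%VS ->
    (forall W, mul_stable W -> W != 0%VS -> (W <= U)%VS -> W = U) ->
  exists y, [/\ y \in U, y != 0 & commuting_tensor y].
Proof.
move=> stU; rewrite -vpick0; set x := vpick U => nzx minU.
have Ux : x \in U by apply: memv_pick.
have [j nzj] : exists j, col j x != 0.
  apply: NNPP => nex; case/eqP: nzx; apply/matrixP => i j.
  have : col j x = 0 by apply/eqP; apply: contraT => nz; case: nex; exists j.
  by move/matrixP/(_ i 0); rewrite !mxE.
pose f : 'Hom('M[K]_(m, n), 'rV[K]_m) := linfun (trmx \o col j).
have fE y : f y = (col j y)^T by rewrite lfunE.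
have fM (A : 'M_m) y : f (A^T *m y) = f y *m A.
  by rewrite !fE !colE -mulmxA trmx_mul trmxK.
have ker0 : (U :&: lker f)%VS = 0%VS.
  apply: contraNeq nzj => nzker; rewrite -trmx_eq0 -fE -memv_ker.
  suff kerE : (U :&: lker f)%VS = U.
    by have := Ux; rewrite -{1}kerE => /memv_capP[].
  apply: minU nzker (capvSl _ _) => a y /memv_capP[Uy].
  have [Uly Ury] := stU a y Uy; rewrite !memv_cap !memv_ker !fM Uly Ury.
  by move=> /eqP->; rewrite !mul0mx eqxx.
have [a _ /memv_imgP[y Uy ->]|a _ /memv_imgP[y Uy ->]|e [If_e eU eC]] :=
    @ideal_central_unit _ _ _ mulA sp (f @: U)%VS.
- by rewrite -mul_lmulmx -fM memv_img //; case: (stU a y Uy).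
- by rewrite -mul_rmulmx -fM memv_img //; case: (stU a y Uy).
have /memv_imgP[z Uz ez] := If_e; exists z; split=> // [|a].
  have [efx _] := eU (f x) (memv_img f Ux).
  apply: contraNneq nzj => z0; rewrite -trmx_eq0 -fE -efx ez z0 linear0.
  by rewrite linear0l.
have [Ulz Urz] := stU a z Uz; apply/eqP; rewrite -subr_eq0 -memv0 -ker0.
rewrite memv_cap memvB // memv_ker linearB /= !fM -ez.
by rewrite mul_lmulmx mul_rmulmx eC subrr.
Qed.

Lemma exists_commuting_tensor U : mul_stable U -> U != 0%VS ->
  exists y, [/\ y \in U, y != 0 & commuting_tensor y].
Proof.
move=> stU nzU; have [|W [stW nzW sWU] minW] := @exists_minimal_vspace _ _
    (fun W => [/\ mul_stable W, W != 0%VS & (W <= U)%VS]).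
  by exists U.
have [|y [Wy nzy yC]] := minimal_stable_commuting_tensor stW nzW.
  by move=> W' *; apply: minW => //; split=> //; apply: subv_trans sWU.
by exists y; split=> //; apply: subvP Wy.
Qed.

End CommutingTensors.

Section CentralTensors.
Variables (K : fieldType) (m n : nat).
Variables (mulV : {bilinear 'rV[K]_m -> 'rV[K]_m -> 'rV[K]_m}).
Variables (mulW : {bilinear 'rV[K]_n -> 'rV[K]_n -> 'rV[K]_n}).
Implicit Types (y : 'M[K]_(m, n)) (U : {vspace 'M[K]_(m, n)}).

Definition central_tensor y : Prop :=
  commuting_tensor mulV y /\ commuting_tensor mulW y^T.

(* The columns of [y] span its left tensor factors, its rows the right ones. *)
Lemma central_tensor_decomposition y : central_tensor y ->
  exists r (z : 'I_r -> 'rV_m) (w : 'I_r -> 'rV_n),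
    [/\ y = \sum_k z k *t w k, forall k a, mulV a (z k) = mulV (z k) a
      & forall k b, mulW b (w k) = mulW (w k) b].
Proof.
move=> [yV yW]; exists (\rank y), (fun k => (col k (col_base y))^T).
exists (fun k => row k (row_base y)); split=> [|k a|k b].
- rewrite -{1}(mulmx_base y); apply/matrixP=> i j; rewrite mxE summxE.
  by apply: eq_bigr => k _; rewrite trmxK [RHS]mxE big_ord1 !mxE.
- have /row_freeP[B rB] := row_base_free y.
  have colE' : col_base y = y *m B.
    by rewrite -[X in _ = X *m B](mulmx_base y) -mulmxA rB mulmx1.
  rewrite -mul_lmulmx -mul_rmulmx; apply: trmx_inj.
  by rewrite !trmx_mul !trmxK colE colE' !mulmxA yV.
have /row_fullP[B cB] := col_base_full y.
have rowE' : row_base y = B *m y.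
  by rewrite -[X in _ = B *m X](mulmx_base y) mulmxA cB mul1mx.
have yWT : y *m lmulmx mulW b = y *m rmulmx mulW b.
  by apply: trmx_inj; rewrite !trmx_mul yW.
by rewrite -mul_lmulmx -mul_rmulmx rowE rowE' -!mulmxA yWT.
Qed.

Hypotheses (mulVA : associative mulV) (mulWA : associative mulW).
Hypotheses (spV : semiprime mulV) (spW : semiprime mulW).

Lemma exists_central_tensor U : mul_stable mulV U ->
    (forall b y, y \in U ->
      y *m lmulmx mulW b \in U /\ y *m rmulmx mulW b \in U) ->
    U != 0%VS ->
  exists y, [/\ y \in U, y != 0 & central_tensor y].
Proof.
move=> stV stW nzU.
have [y [Uy nzy yC]] := exists_commuting_tensor mulVA spV stV nzU.
have [|k w w' [Uw wC] [Uw' w'C]|Z ZP] := @vspace_of_pred K 'M[K]_(n, m)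
    (fun w => w^T \in U /\ commuting_tensor mulV w^T).
- by rewrite trmx0 mem0v; split=> // a; rewrite !mulmx0.
- rewrite linearP; split=> [|a]; first by rewrite memvD ?memvZ.
  by rewrite !mulmxDr -!scalemxAr wC w'C.
have stZ : mul_stable mulW Z.
  move=> b w /ZP[Uw wC]; have [Uwl Uwr] := stW b _ Uw.
  by split; apply/ZP; rewrite trmx_mul trmxK; split=> // a; rewrite !mulmxA wC.
have nzZ : Z != 0%VS.
  apply: contraNneq nzy => Z0; rewrite -trmx_eq0 -memv0 -Z0; apply/ZP.
  by rewrite trmxK.
have [w [/ZP[Uw wV] nzw wW]] := exists_commuting_tensor mulWA spW stZ nzZ.
by exists w^T; rewrite trmx_eq0; split=> //; split; rewrite ?trmxK.
Qed.

End CentralTensors.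

(* A central tensor acts by multiplication as a [sandwich] of commuting matrices
   with separable minimal polynomials. *)
Lemma central_tensor_reduced (K : fieldType) m n
    (mulV : {bilinear 'rV[K]_m -> 'rV[K]_m -> 'rV[K]_m})
    (mulW : {bilinear 'rV[K]_n -> 'rV[K]_n -> 'rV[K]_n}) y :
    perfect_field K -> associative mulV -> associative mulW ->
    semiprime mulV -> semiprime mulW -> central_tensor mulV mulW y ->
  tmul mulV mulW y y = 0 -> y = 0.
Proof.
case: m mulV y => [|m] mulV y; first by rewrite [y]flatmx0.
case: n mulW y => [|n] mulW y; first by rewrite [y]thinmx0.
move=> perfK mulVA mulWA spV spW /central_tensor_decomposition.
move=> [r [z [w [yE zC wC]]]] yy0.
have [u uP] := semiprime_unit mulVA spV.
have [v vP] := semiprime_unit mulWA spW.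
have yQ Q : tmul mulV mulW y Q
    = sandwich (fun k => lmulmx mulV (z k)) (fun k => lmulmx mulW (w k)) Q.
  by rewrite {1}yE linear_sumlz; apply: eq_bigr => k _; rewrite /= tmul_tensorl.
have y1 : tmul mulV mulW y (u *t v) = y.
  rewrite tmul_tensorr (lrmulmx1 uP).2 (lrmulmx1 vP).2.
  by rewrite trmx1 mul1mx mulmx1.
rewrite -y1 yQ; apply: separable_sandwich_reduced => [i j|i j|i|i|].
- by rewrite /comm_mx -!lmulmxM // zC.
- by rewrite /comm_mx -!lmulmxM // wC.
- exact/semiprime_centroid_mxminpoly_separable/centroid_lmulmx.
- exact/semiprime_centroid_mxminpoly_separable/centroid_lmulmx.
by rewrite -!yQ y1 yy0.
Qed.

Lemma tensor_semiprime (K : fieldType) m n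
    (mulV : {bilinear 'rV[K]_m -> 'rV[K]_m -> 'rV[K]_m})
    (mulW : {bilinear 'rV[K]_n -> 'rV[K]_n -> 'rV[K]_n}) :
    perfect_field K -> associative mulV -> associative mulW ->
    semiprime mulV -> semiprime mulW ->
  semiprime (tmul mulV mulW).
Proof.
move=> perfK mulVA mulWA spV spW.
have [u uP] := semiprime_unit mulVA spV.
have [v vP] := semiprime_unit mulWA spW.
have [lu ru] := lrmulmx1 uP; have [lv rv] := lrmulmx1 vP.
apply: semiprime_of_ideals => [|I idl idr cube0]; first exact: tmulA.
have stV : mul_stable mulV I.
  move=> a y Iy; split.
    by have /= := idl (a *t v) y Iy; rewrite tmul_tensorl lv mulmx1.
  by have /= := idr (a *t v) y Iy; rewrite tmul_tensorr rv mulmx1.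
have stW b y : y \in I -> y *m lmulmx mulW b \in I /\ y *m rmulmx mulW b \in I.
  move=> Iy; split.
    by have /= := idl (u *t b) y Iy; rewrite tmul_tensorl lu trmx1 mul1mx.
  by have /= := idr (u *t b) y Iy; rewrite tmul_tensorr ru trmx1 mul1mx.
apply/eqP; apply: contraT => nzI.
have [y [Iy nzy yC]] := exists_central_tensor mulVA mulWA spV spW stV stW nzI.
case/eqP: nzy; apply: (central_tensor_reduced perfK mulVA mulWA) => //.
have /= := cube0 _ _ (u *t v) Iy Iy.
by rewrite tmul_tensorr ru rv trmx1 mul1mx mulmx1.
Qed.

Section Separability.
Variables (K : fieldType) (n : nat).
Variable mul : {bilinear 'rV[K]_n -> 'rV[K]_n -> 'rV[K]_n}.
Local Notation "P ** Q" := (tmul mul (applyr mul) P Q)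
  (at level 40, left associativity).

Definition contract : 'M[K]_n -> 'rV[K]_n := tensor_lift mul.

HB.instance Definition _ := GRing.Linear.copy contract (tensor_lift mul).

Lemma contract_tensor a b : contract (a *t b) = mul a b.
Proof.
by apply: tensor_liftE; split=> c k x y; [apply: linearPl | apply: linearPr].
Qed.

Definition separability_idempotent (P : 'M[K]_n) : Prop :=
  (forall a, (lmulmx mul a)^T *m P = P *m rmulmx mul a) /\
  (forall x, mul (contract P) x = x /\ mul x (contract P) = x).

Hypotheses (mulA : associative mul) (sp : semiprime mul).

Lemma contract_tmul_tensorl a b P :
  contract ((a *t b) ** P) = mul (mul a (contract P)) b.
Proof.
elim/tensor_ind: P => [k P Q IHP IHQ|c d].
  by rewrite linearPr !linearP linearPl /= IHP IHQ.
by rewrite tmul_tensor !contract_tensor /= !mulA.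
Qed.

(* The complement of a right unit of the left ideal [contract P = 0] of the
   enveloping algebra. *)
Lemma exists_separability_idempotent :
  perfect_field K -> exists P, separability_idempotent P.
Proof.
move=> perfK; have mulA' := applyr_associative mulA.
have sp' := semiprime_applyr mulA sp.
have [u uP] := semiprime_unit mulA sp; have [lu ru] := lrmulmx1 uP.
pose I := lker (linfun contract).
have IP P : P \in I = (contract P == 0) by rewrite memv_ker lfunE.
have idI : left_ideal (tmul mul (applyr mul)) I.
  move=> X P; rewrite !IP => /eqP P0.
  elim/tensor_ind: X => [k X Y /eqP IHX /eqP IHY|a b].
    by rewrite linearPl linearP /= IHX IHY scaler0 addr0.
  by rewrite contract_tmul_tensorl P0 linear0r linear0l.
have [e Ie eP] := left_ideal_unit (tmulA mulA mulA')
  (tensor_semiprime perfK mulA mulA' sp sp') idI.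
have mull a Q : (a *t u) ** Q = (lmulmx mul a)^T *m Q.
  by rewrite tmul_tensorl -/(rmulmx mul u) ru mulmx1.
have mulr a Q : (u *t a) ** Q = Q *m rmulmx mul a.
  by rewrite tmul_tensorl -/(rmulmx mul a) lu trmx1 mul1mx.
have mul1 Q : Q ** (u *t u) = Q.
  rewrite tmul_tensorr ru trmx1 mul1mx -[rmulmx _ u]/(lmulmx mul u).
  by rewrite lu mulmx1.
have contract_ue : contract (u *t u - e) = u.
  move: Ie; rewrite IP linearB /= contract_tensor (uP u).1 => /eqP->.
  exact: subr0.
exists (u *t u - e); split=> [a|x]; last by rewrite contract_ue.
apply/eqP; rewrite -subr_eq0 -mull -mulr -linearBl linearBr /= mul1.
rewrite eP ?subrr // IP linearB /= !contract_tensor (uP a).1 (uP a).2.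
by rewrite subrr.
Qed.

End Separability.

(** * Finite-dimensional semisimple subalgebras *)

Section NalgProduct.
Variables (K : fieldType) (R : nalgType K).

Fact nmul_is_bilinear : bilinear_map (nmul R).
Proof. by split=> a k x y /=; rewrite ?nmulDl ?nmulDr ?nmulZl ?nmulZr. Qed.

HB.instance Definition _ :=
  bilinear_isBilinear.Build K R R R _ _ (nmul R) nmul_is_bilinear.

HB.instance Definition _ (x : R) :=
  GRing.isLinear.Build K R R _ (nmul R x) (nmul_is_bilinear.2 x).

End NalgProduct.

Section SubspacePredicates.
Variables (K : fieldType) (R : nalgType K) (S : R -> Prop).
Hypothesis subS : is_subspace S.

Lemma subspace0 : S 0. Proof. by case: subS. Qed.

Lemma subspaceD x y : S x -> S y -> S (x + y).
Proof. by case: subS => _ SD _; apply: SD. Qed.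

Lemma subspaceZ k x : S x -> S (k *: x).
Proof. by case: subS => _ _; apply. Qed.

Lemma subspaceN x : S x -> S (- x).
Proof. by rewrite -scaleN1r; apply: subspaceZ. Qed.

Lemma subspaceB x y : S x -> S y -> S (x - y).
Proof. by move=> Sx Sy; apply/subspaceD/subspaceN. Qed.

Lemma subspace_sum I (r : seq I) (F : I -> R) :
  (forall i, S (F i)) -> S (\sum_(i <- r) F i).
Proof.
by move=> SF; apply: big_ind; [exact: subspace0 | exact: subspaceD |].
Qed.

Lemma subspace_tensor_lift m n (B : 'rV[K]_m -> 'rV[K]_n -> R) P :
  (forall a b, S (B a b)) -> S (tensor_lift B P).
Proof.
move=> SB; apply: subspace_sum => i; apply: subspace_sum => j.
exact: subspaceZ.
Qed.

Lemma subspace_linear_rV n (f : {linear 'rV[K]_n -> R}) :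
  (forall i, S (f 'e_i)) -> forall v, S (f v).
Proof.
move=> Sf v; rewrite [v]row_sum_delta linear_sum.
by apply: subspace_sum => i; rewrite linearZ; apply: subspaceZ.
Qed.

Lemma subspaceI T : is_subspace T -> is_subspace (fun x => S x /\ T x).
Proof.
case: subS => S0 SD SZ [T0 TD TZ].
by split=> // [x y [Sx Tx] [Sy Ty]|k x [Sx Tx]]; split; auto.
Qed.

End SubspacePredicates.

Definition lincomb (K : fieldType) (V : lmodType K) n (b : 'I_n -> V)
  (v : 'rV[K]_n) : V := \sum_i v 0 i *: b i.

Fact lincomb_is_linear (K : fieldType) (V : lmodType K) n (b : 'I_n -> V) :
  linear (lincomb b).
Proof.
move=> k v w; rewrite scaler_sumr -big_split; apply: eq_bigr => i _ /=.
by rewrite !mxE scalerDl scalerA.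
Qed.

HB.instance Definition _ (K : fieldType) (V : lmodType K) n (b : 'I_n -> V) :=
  GRing.isLinear.Build K 'rV[K]_n V _ (lincomb b) (lincomb_is_linear b).

Lemma linear_lift (K : fieldType) (U V : lmodType K) (p : {linear U -> V}) n
    (f : {linear 'rV[K]_n -> V}) :
    (forall y, exists x, p x = y) ->
  exists g : {linear 'rV[K]_n -> U}, forall v, p (g v) = f v.
Proof.
move=> p_surj.
have /fin_all_exists[b bP] (i : 'I_n) : exists x, p x = f 'e_i by [].
exists (lincomb b) => v; rewrite [in RHS](row_sum_delta v) !linear_sum.
by apply: eq_bigr => i _; rewrite !linearZ bP.
Qed.

Section FiniteDimension.
Variables (K : fieldType) (R : nalgType K).
Implicit Types (S : R -> Prop) (s : seq R).

Lemma in_span_subspace s : is_subspace (in_span s).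
Proof.
split=> [|_ _ [c ->] [d ->]|k _ [c ->]].
- by exists (fun=> 0); rewrite big1 // => i _; rewrite scale0r.
- exists (fun i => c i + d i); rewrite -big_split; apply: eq_bigr => i _.
  by rewrite scalerDl.
- exists (fun i => k * c i); rewrite scaler_sumr; apply: eq_bigr => i _.
  by rewrite scalerA.
Qed.

Lemma mem_in_span s x : x \in s -> in_span s x.
Proof.
rewrite -index_mem => lt_xs; pose j := Ordinal lt_xs.
exists (fun i => (i == j)%:R); rewrite (bigD1 j) //= eqxx scale1r nth_index.
  by rewrite big1 ?addr0 // => i /negPf->; rewrite scale0r.
by rewrite -index_mem.
Qed.

Lemma fin_dim_range S n (f : {linear 'rV[K]_n -> R}) :
  (forall x, S x <-> exists v, x = f v) -> fin_dim S.
Proof.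
move=> SP; exists [seq f 'e_i | i <- enum 'I_n] => x.
split=> [/SP[v ->]|[c ->]].
  apply: subspace_linear_rV => [|i]; first exact: in_span_subspace.
  by apply: mem_in_span; apply: map_f; rewrite mem_enum.
have subS : is_subspace S.
  split=> [|y z /SP[v ->] /SP[w ->]|k y /SP[v ->]]; apply/SP.
  - by exists 0; rewrite linear0.
  - by exists (v + w); rewrite linearD.
  - by exists (k *: v); rewrite linearZ.
apply: subspace_sum => // i; apply: subspaceZ => //.
by have /mapP[j _ ->] := mem_nth 0 (ltn_ord i); apply/SP; exists 'e_j.
Qed.

(* Restrict the linear combinations of a spanning family to a complement of
   the relations. *)
Lemma fin_dim_coordinates S : fin_dim S ->
  exists n (iota : {linear 'rV[K]_n -> R}),
    injective iota /\ forall x, S x <-> exists v, x = iota v.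
Proof.
case=> s sP; pose f : {linear 'rV[K]_(size s) -> R} := lincomb (fun i => s`_i).
have SP x : S x <-> exists v, x = f v.
  rewrite sP; split=> [[c ->]|[v ->]]; last by exists (fun i => v 0 i).
  by exists (\row_i c i); apply: eq_bigr => i _; rewrite mxE.
have [|k v w v0 w0|ker kerP] := @vspace_of_pred _ _ (fun v => f v = 0).
- exact: linear0.
- by rewrite linearP v0 w0 scaler0 addr0.
pose b := vbasis ker^C.
pose iota : {linear 'rV[K]_(\dim ker^C) -> R} := lincomb (fun i => f b`_i).
have iotaE v : iota v = f (\sum_i v 0 i *: b`_i).
  by rewrite linear_sum; apply: eq_bigr => i _; rewrite linearZ.
have iota0 v : iota v = 0 -> v = 0.
  rewrite iotaE => /kerP ker_v.
  have : \sum_i v 0 i *: b`_i \in (ker :&: ker^C)%VS.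
    rewrite memv_cap ker_v; apply: rpred_sum => i _; apply: rpredZ.
    by apply/vbasis_mem/mem_nth; rewrite size_tuple.
  rewrite capv_compl memv0 => /eqP v0; apply/rowP=> i; rewrite mxE.
  by have /freeP/(_ (v 0) v0) := basis_free (vbasisP ker^C).
exists (\dim ker^C), iota; split=> [|x]; first exact: raddf_inj.
rewrite SP; split=> [[v ->]|[v ->]]; last by rewrite iotaE; eexists.
have /memv_addP[w /kerP w0 [w' Cw' ->]] : v \in (ker + ker^C)%VS.
  by rewrite addv_complf memvf.
exists (\row_i coord b i w'); rewrite linearD w0 add0r iotaE.
rewrite {1}(coord_vbasis Cw'); congr (f _); apply: eq_bigr => i _.
by rewrite mxE.
Qed.

Fact iter_is_linear k (f : {linear R -> R}) : linear (iter k f).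
Proof. by move=> a x y; elim: k => // k IH; rewrite !iterS IH linearP. Qed.

HB.instance Definition _ k (f : {linear R -> R}) :=
  GRing.isLinear.Build K R R _ (iter k f) (iter_is_linear k f).

(* In coordinates, choose [k] such that the [k]-th power of the matrix of [f]
   has minimal rank. *)
Lemma fitting_power S (f : {linear R -> R}) :
    fin_dim S -> (forall x, S x -> S (f x)) ->
  exists k,
    (forall x, S x -> exists2 y, S y & iter k f x = iter k.+1 f y) /\
    (forall x, S x -> iter k f (iter k f x) = 0 -> iter k f x = 0).
Proof.
move=> /fin_dim_coordinates[n [iota [iota_inj SP]]] Sf.
have Siota v : S (iota v) by apply/SP; exists v.
have /fin_all_exists[m mP] (i : 'I_n) : exists v, f (iota 'e_i) = iota v.
  exact/SP/Sf.
pose M : 'M[K]_n := \matrix_i m i.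
have fM v : f (iota v) = iota (v *m M).
  rewrite mulmx_sum_row [in LHS](row_sum_delta v) !linear_sum.
  by apply: eq_bigr => i _; rewrite !linearZ /= mP rowK.
have iter_fM k v : iter k f (iota v) = iota (v *m M ^+ k).
  elim: k v => [|k IH] v; first by rewrite expr0 mulmx1.
  by rewrite iterSr fM IH exprS mulmxA.
have [|k _ min_rank] := @exists_argmin _ (fun=> True) (fun k => \rank (M ^+ k)).
  by exists 0.
have sub_power j : (M ^+ (j + k) <= M ^+ k)%MS by rewrite exprD submxMl.
exists k; split=> x /SP[v ->].
  have /submxP[D MkE] : (M ^+ k <= M ^+ k.+1)%MS.
    rewrite -(mxrank_leqif_sup (sub_power 1)) eqn_leq min_rank //.
    by rewrite mxrankS ?(sub_power 1).
  by exists (iota (v *m D)); rewrite // !iter_fM MkE mulmxA.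
rewrite !iter_fM => /eqP; rewrite raddf_eq0 // => /eqP vMM0.
have /(introT (mxrank_injP _))/eqP cap0 :
    \rank (M ^+ k *m M ^+ k) = \rank (M ^+ k).
  by apply/eqP; rewrite mulmxE -exprD eqn_leq min_rank // mxrankS ?sub_power.
suff -> : v *m M ^+ k = 0 by rewrite linear0.
apply/eqP; rewrite -submx0 -cap0 sub_capmx submxMl.
by apply/sub_kermxP; rewrite -vMM0.
Qed.

End FiniteDimension.

Section SemisimpleSubalgebras.
Variables (K : fieldType) (R : nalgType K).
Implicit Types (S : R -> Prop) (s : seq R).
Local Notation "x ** y" := (nmul R x y) (at level 40, left associativity).

Definition semiprime_sub S : Prop :=
  forall x, S x -> (forall t, S t -> x ** t ** x = 0) -> x = 0.

Definition identity_on S e : Prop := forall x, S x -> e ** x = x /\ x ** e = x.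

Lemma nprod_mull a x s : a ** nprod x s = nprod (a ** x) s.
Proof.
by elim: s a x => //= b s IH a x; rewrite /nprod /= -!/(nprod _ _) IH nmulA.
Qed.

Lemma nprod0 s : nprod (0 : R) s = 0.
Proof. by elim: s => //= b s IH; rewrite /nprod /= linear0l. Qed.

Lemma semiprime_semisimple S :
  is_subalg S -> semiprime_sub S -> semisimple_sub S.
Proof.
move=> [_ SM] spS I [_ IS Il Ir] [k]; elim: k => [|k IH] nilI x Ix.
  by rewrite -[x]/(nprod x [::]) nilI.
apply: IH Ix => {}x s sz Ix Is.
have Iprod y s' : I y -> (forall z, z \in s' -> I z) -> I (nprod y s').
  elim: s' y => //= a s' IHs y Iy Is'; apply: IHs.
    by apply: Il; [apply: IS | apply: Is'; rewrite mem_head].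
  by move=> z zs; apply: Is'; rewrite inE zs orbT.
have Ixs := Iprod x s Ix Is; apply: spS => [|t St]; first exact: IS.
rewrite nprod_mull -nmulA.
have -> : nprod x s ** (t ** x) = nprod x (rcons s (t ** x)).
  by rewrite /nprod -cats1 foldl_cat.
rewrite (nilI x (rcons _ _)) ?nprod0 ?size_rcons ?sz // => z.
by rewrite mem_rcons inE => /orP[/eqP->|/Is //]; apply: Il.
Qed.

Definition coordinates n (mul : 'rV[K]_n -> 'rV[K]_n -> 'rV[K]_n)
    (iota : 'rV[K]_n -> R) S : Prop :=
  [/\ injective iota, forall x, S x <-> exists v, x = iota v
    & forall v w, iota (mul v w) = iota v ** iota w].

Lemma fin_dim_subalg_coordinates S : is_subalg S -> fin_dim S ->
  exists n (mul : {bilinear 'rV[K]_n -> 'rV[K]_n -> 'rV[K]_n})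
      (iota : {linear 'rV[K]_n -> R}),
    associative mul /\ coordinates mul iota S.
Proof.
move=> [_ SM] /fin_dim_coordinates[n [iota [iota_inj SP]]].
have Siota v : S (iota v) by apply/SP; exists v.
have /fin_all_exists[c cP] (ij : 'I_n * 'I_n) :
  exists v, iota 'e_(ij.1) ** iota 'e_(ij.2) = iota v by apply/SP/SM.
pose m (v w : 'rV[K]_n) := \sum_i \sum_j (v 0 i * w 0 j) *: c (i, j).
have iotaM v w : iota (m v w) = iota v ** iota w.
  rewrite /m linear_sum [in RHS](row_sum_delta v) linear_sum linear_sumlz.
  apply: eq_bigr => i _.
  rewrite linear_sum [in RHS](row_sum_delta w) linear_sum linear_sumr.
  apply: eq_bigr => j _.
  by rewrite !linearZ /= linearZl_LR scalerA mulrC -cP.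
have bil_m : bilinear_map m.
  split=> x k y z; apply: iota_inj; rewrite linearP !iotaM linearP.
    exact: linearPl.
  exact: linearPr.
pose mul : {bilinear 'rV[K]_n -> 'rV[K]_n -> 'rV[K]_n} :=
  HB.pack m (bilinear_isBilinear.Build _ _ _ _ _ _ m bil_m).
exists n, mul, iota; split=> // x y z; apply: iota_inj.
by rewrite !iotaM nmulA.
Qed.

Lemma semisimple_coordinates_semiprime S n
    (mul : {bilinear 'rV[K]_n -> 'rV[K]_n -> 'rV[K]_n})
    (iota : {linear 'rV[K]_n -> R}) :
    associative mul -> coordinates mul iota S -> semisimple_sub S ->
  semiprime mul.
Proof.
move=> mulA [iota_inj SP iotaM] ssS.
apply: semiprime_of_ideals => // I idl idr cube0.
have ideal_iI : is_ideal_in S (fun x => exists2 v, v \in I & x = iota v).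
  split=> [|_ [v _ ->]|_ _ /SP[w ->] [v Iv ->]|_ _ /SP[w ->] [v Iv ->]].
  - split=> [|_ _ [v Iv ->] [w Iw ->]|k _ [v Iv ->]].
    + by exists 0; rewrite ?mem0v ?linear0.
    + by exists (v + w); rewrite ?memvD ?linearD.
    + by exists (k *: v); rewrite ?memvZ ?linearZ.
  - by apply/SP; exists v.
  - by exists (mul w v); rewrite ?iotaM ?idl.
  - by exists (mul v w); rewrite ?iotaM ?idr.
apply/eqP; rewrite -subv0; apply/subvP => v Iv; rewrite memv0.
apply/eqP/iota_inj; rewrite linear0.
apply: ssS ideal_iI _ _ _; last by exists v.
exists 2%N => x [|y [|z []]] // _ [v1 Iv1 ->] Is.
have [v2 Iv2 ->] := Is _ (mem_head _ _).
have [v3 Iv3 ->] := Is z (mem_last y [:: z]).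
by rewrite /nprod /= -!iotaM cube0 ?linear0.
Qed.

Lemma fdss_coordinates S : fdss_subalg S ->
  exists n (mul : {bilinear 'rV[K]_n -> 'rV[K]_n -> 'rV[K]_n})
      (iota : {linear 'rV[K]_n -> R}),
    [/\ associative mul, semiprime mul & coordinates mul iota S].
Proof.
move=> [algS finS ssS].
have [n [mul [iota [mulA coordS]]]] := fin_dim_subalg_coordinates algS finS.
exists n, mul, iota; split=> //.
exact: semisimple_coordinates_semiprime coordS ssS.
Qed.

Lemma fdss_semiprime S : fdss_subalg S -> semiprime_sub S.
Proof.
move=> /fdss_coordinates[n [mul [iota [_ sp [iota_inj SP iotaM]]]]].
move=> _ /SP[v ->] vtv; rewrite (sp v) ?linear0 // => t.
by apply: iota_inj; rewrite !iotaM linear0 vtv //; apply/SP; exists t.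
Qed.

Lemma fdss_unit S : fdss_subalg S -> exists2 e, S e & identity_on S e.
Proof.
move=> /fdss_coordinates[n [mul [iota [mulA sp [_ SP iotaM]]]]].
have [u uP] := semiprime_unit mulA sp.
exists (iota u); first by apply/SP; exists u.
by move=> _ /SP[v ->]; rewrite -!iotaM (uP v).1 (uP v).2.
Qed.

Definition compress (q x : R) : R := q ** (x ** q).

Fact compress_is_linear q : linear (compress q).
Proof. by move=> k x y; rewrite /compress linearPl linearPr. Qed.

HB.instance Definition _ q :=
  GRing.isLinear.Build K R R _ (compress q) (compress_is_linear q).

Lemma iter_compress_mul q k x y z :
  iter k (compress q) x ** y ** iter k (compress q) z
    = iter k (compress q) (x ** iter k (compress q) y ** z).
Proof.
elim: k y => // k IH y; rewrite [iter _ _ y]iterSr !iterS -IH /compress.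
by rewrite !nmulA.
Qed.

Lemma mul_iter_compress a q k x : a ** q = q ** a ->
  a ** iter k (compress q) x = iter k (compress q) (a ** x).
Proof. by move=> aq; elim: k => //= k <-; rewrite /compress !nmulA aq. Qed.

Lemma iter_compress_mulC a q k x : a ** q = q ** a ->
  iter k (compress q) x ** a = iter k (compress q) (x ** a).
Proof. by move=> aq; elim: k => //= k <-; rewrite /compress -!nmulA aq. Qed.

Definition corner S q k x : Prop := exists2 t, S t & x = iter k (compress q) t.

Lemma subalg_iter_compress S q k x :
  is_subalg S -> S q -> S x -> S (iter k (compress q) x).
Proof.
by move=> [_ SM] Sq Sx; elim: k => //= k Sk; apply: (SM) => //; apply: SM.
Qed.

Lemma fdss_corner_subalg S q k :
  fdss_subalg S -> S q -> is_subalg (corner S q k).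
Proof.
move=> fdS Sq; have [algS _ _] := fdS; have [subS SM] := algS.
have [e Se eP] := fdss_unit fdS; split; first split.
- by exists 0; [apply: subspace0 | rewrite linear0].
- move=> _ _ [s Ss ->] [t St ->].
  by exists (s + t); [apply: subspaceD | rewrite linearD].
- move=> c _ [s Ss ->].
  by exists (c *: s); [apply: subspaceZ | rewrite linearZ].
move=> _ _ [s Ss ->] [t St ->]; exists (s ** iter k (compress q) e ** t).
  by apply: (SM) => //; apply: (SM) => //; apply: subalg_iter_compress.
by rewrite -iter_compress_mul (eP _ (subalg_iter_compress k algS Sq Ss)).2.
Qed.

Lemma fdss_corner S q : fdss_subalg S -> S q ->
  exists k, fdss_subalg (corner S q k) /\
    forall x, corner S q k x -> corner S q k.+1 x.
Proof.
move=> fdS Sq; have [algS finS _] := fdS.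
have Siter j t : S t -> S (iter j (compress q) t).
  exact: subalg_iter_compress.
have [k [range_step ker_step]] := fitting_power finS (Siter 1%N).
exists k; split=> [|_ [t /range_step[s Ss ->] ->]]; last by exists s.
have algC := fdss_corner_subalg k fdS Sq; split=> //.
  have [n [iota [_ SP]]] := fin_dim_coordinates finS.
  apply: (fin_dim_range (f := iter k (compress q) \o iota)) => x.
  split=> [[_ /SP[v ->] ->]|[v ->]]; first by exists v.
  by exists (iota v) => //; apply/SP; exists v.
apply: semiprime_semisimple => // x [t St ->] xCx0; apply: ker_step => //.
apply: (fdss_semiprime fdS) => [|s Ss]; first exact/Siter/Siter.
by rewrite iter_compress_mul xCx0 ?linear0 //; exists s.
Qed.

End SemisimpleSubalgebras.

(** * Linear maps multiplicative modulo a subspace *)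

Section MultiplicativeModulo.
Variables (K : fieldType) (R : nalgType K) (n : nat).
Variables (mul : {bilinear 'rV[K]_n -> 'rV[K]_n -> 'rV[K]_n}).
Variables (sigma : {linear 'rV[K]_n -> R}).
Implicit Types (S T J N : R -> Prop).
Local Notation "x ** y" := (nmul R x y) (at level 40, left associativity).

Definition stable_under S : Prop :=
  forall a x, S x -> S (sigma a ** x) /\ S (x ** sigma a).

Definition mul_defect a b : R := sigma a ** sigma b - sigma (mul a b).

Definition multiplicative_mod S : Prop := forall a b, S (mul_defect a b).

Lemma stable_under_basis S : is_subspace S ->
    (forall i x, S x -> S (sigma 'e_i ** x) /\ S (x ** sigma 'e_i)) ->
  stable_under S.
Proof.
move=> subS stS a x Sx; split.
  apply: (subspace_linear_rV subS (f := applyr (nmul R) x \o sigma)) => i.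
  by case: (stS i x Sx).
apply: (subspace_linear_rV subS (f := nmul R x \o sigma)) => i.
by case: (stS i x Sx).
Qed.

Lemma multiplicative_mod_basis S : is_subspace S ->
  (forall i j, S (mul_defect 'e_i 'e_j)) -> multiplicative_mod S.
Proof.
move=> subS defS a b; apply: (subspace_linear_rV subS
  (f := (applyr (nmul R) (sigma b) \o sigma) \- (sigma \o applyr mul b))) => i.
apply: (subspace_linear_rV subS
  (f := (nmul R (sigma 'e_i) \o sigma) \- (sigma \o mul 'e_i))) => j.
exact: defS.
Qed.

Lemma stable_underI S T :
  stable_under S -> stable_under T -> stable_under (fun x => S x /\ T x).
Proof.
move=> stS stT a x [Sx Tx]; have [lS rS] := stS a x Sx.
by have [lT rT] := stT a x Tx.
Qed.

Lemma ideal_stable J : is_ideal J -> stable_under J.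
Proof. by move=> [_ _ Jl Jr] a x Jx; split; [apply: Jl | apply: Jr]. Qed.

(* If [P = \sum x_i (x) y_i] and [u] is the unit, a derivation [D] is the
   commutator with [\sum x_i D(y_i) - D(u) u]; the second term is there because
   [M] need not be unital. *)
Lemma derivation_inner (M : R -> Prop) (D : 'rV[K]_n -> R) (P : 'M[K]_n) :
    separability_idempotent mul P -> is_subspace M -> stable_under M ->
    (forall a b x, M x -> sigma a ** (sigma b ** x) = sigma (mul a b) ** x) ->
    (forall a b x, M x -> x ** sigma a ** sigma b = x ** sigma (mul a b)) ->
    linear D -> (forall a, M (D a)) ->
    (forall a b, D (mul a b) = sigma a ** D b + D a ** sigma b) ->
  exists2 w, M w & forall a, D a = sigma a ** w - w ** sigma a.
Proof.
move=> [PC]; set u := contract mul P => uP subM stM lM rM linD MD DM.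
pose B x y := sigma x ** D y; pose w := tensor_lift B P.
have bilB : bilinear_map B.
  by split=> [y|x] k z z' /=; rewrite /B ?linD ?linearP ?linearPl ?linearPr.
have left_mul a : sigma a ** w = tensor_lift B ((lmulmx mul a)^T *m P).
  rewrite -[_ *m P]mulmx1 tensor_lift_mulmx // linear_tensor_lift.
  by apply: eq_tensor_lift => x y; rewrite mulmx1 mul_lmulmx; apply: lM.
have right_mul a :
    w ** sigma a + sigma u ** D a = tensor_lift B (P *m rmulmx mul a).
  rewrite -[P in RHS]mul1mx -trmx1 tensor_lift_mulmx // linearl_tensor_lift.
  rewrite linear_tensor_lift linearl_tensor_lift -[X in X + _]scale1r.
  rewrite -tensor_lift_linear_fun; apply: eq_tensor_lift => x y.
  by rewrite scale1r mulmx1 mul_rmulmx /B DM linearDr /= -lM // -nmulA addrC.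
have Duu a : sigma a ** (D u ** sigma u) = 0.
  rewrite nmulA -[sigma a ** D u](addrK (D a ** sigma u)) -DM (uP a).2.
  by rewrite linearBl /= rM // (uP u).1 subrr.
exists (w - D u ** sigma u) => [|a].
  apply: (subspaceB subM); last by case: (stM u _ (MD u)).
  by apply: subspace_tensor_lift => // x y; case: (stM x _ (MD y)).
rewrite linearBr linearBl /= Duu subr0 left_mul PC -right_mul rM // (uP a).1.
rewrite -{1}[a](uP a).1 DM opprB [X in _ = X + _]addrC addrACA subrr.
by rewrite addr0.
Qed.

Definition annihilator N x : Prop := forall z, N z -> x ** z = 0 /\ z ** x = 0.

Lemma annihilator_subspace N : is_subspace (annihilator N).
Proof.
split=> [z _|x y x0 y0 z Nz|k x x0 z Nz]; first by rewrite linear0l linear0r.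
  have [xz zx] := x0 z Nz; have [yz zy] := y0 z Nz.
  by rewrite linearDl linearDr /= xz yz zx zy addr0.
by have [xz zx] := x0 z Nz; rewrite linearZl_LR linearZr_LR /= xz zx scaler0.
Qed.

Lemma annihilator_stable N : stable_under N -> stable_under (annihilator N).
Proof.
move=> stN a x x0; split=> z Nz; have [xz zx] := x0 z Nz.
  rewrite -nmulA xz linear0r nmulA; split=> //.
  by case: (x0 _ (stN a z Nz).2).
rewrite nmulA zx linear0l -nmulA; split=> //.
by case: (x0 _ (stN a z Nz).1).
Qed.

Hypotheses (mulA : associative mul) (sp : semiprime mul).

(* The commutators with [e] annihilate [N], and [sigma] is multiplicative on the
   annihilator of [N]. *)
Lemma exists_commuting_local_unit J N e :
    perfect_field K -> is_ideal J -> J e ->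
    stable_under N -> multiplicative_mod N -> identity_on N e ->
  exists q, [/\ J q, identity_on N q & forall a, sigma a ** q = q ** sigma a].
Proof.
move=> perfK idJ Je stN modN eN; have [subJ _ _ _] := idJ.
have stJ := ideal_stable idJ.
have [P sepP] := exists_separability_idempotent mulA sp perfK.
pose D a := sigma a ** e - e ** sigma a.
have eC d : N d -> d ** e = e ** d by move=> /eN[-> ->].
have [||a b x [_ x0]|a b x [_ x0]|||a b|w [Jw w0] Dw] :=
    derivation_inner (M := fun x => J x /\ annihilator N x) (D := D) sepP.
- exact/subspaceI/annihilator_subspace.
- exact/stable_underI/annihilator_stable.
- by apply/eqP; rewrite nmulA -subr_eq0 -linearBl /= (x0 _ (modN a b)).2.
- by apply/eqP; rewrite -nmulA -subr_eq0 -linearBr /= (x0 _ (modN a b)).1.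
- move=> k a b; rewrite /D linearP linearPl linearPr scalerBr opprD.
  by rewrite addrACA.
- move=> a; split=> [|z Nz].
    by apply: subspaceB => //; case: (stJ a e Je).
  have [Naz Nza] := stN a z Nz; rewrite linearBl linearBr /=.
  rewrite -!nmulA (eN z Nz).1 (eN _ Naz).1 subrr.
  by rewrite !nmulA (eN _ Nza).2 (eN z Nz).2 subrr.
- rewrite /D -[sigma (mul a b)](subKr (sigma a ** sigma b)) linearBl linearBr.
  rewrite /= (eC _ (modN a b)) opprB addrA subrK linearBr linearBl /= !nmulA.
  by rewrite addrA subrK.
exists (e - w); split=> [|x Nx|a]; first exact: subspaceB.
  have [ex xe] := eN x Nx; have [wx xw] := w0 x Nx.
  by rewrite linearBl linearBr /= ex xe wx xw subr0.
move/eqP: (Dw a); rewrite /D subr_eq linearBr linearBl /= => /eqP->.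
by rewrite [X in X - _]addrC addrA addrAC addrK.
Qed.

Lemma corner_stable T q k :
    is_subalg T -> T q -> (forall x, corner T q k x -> corner T q k.+1 x) ->
    (forall a, sigma a ** q = q ** sigma a) -> (forall a, T (sigma a ** q)) ->
  stable_under (corner T q k).
Proof.
move=> [_ TM] Tq cornerS qC Tsq a x /cornerS[t Tt ->].
rewrite iterSr /compress; split.
  exists (sigma a ** q ** (t ** q)); first by apply: (TM) => //; apply: TM.
  by rewrite mul_iter_compress // nmulA.
exists (q ** (t ** (sigma a ** q))); first by apply: (TM) => //; apply: TM.
by rewrite iter_compress_mulC // qC !nmulA.
Qed.

Definition extension T x : Prop := exists v, T (x - sigma v).

Section Extension.
Variable T : R -> Prop.
Hypotheses (fdT : fdss_subalg T) (stT : stable_under T).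
Hypothesis modT : multiplicative_mod T.

Lemma congr_mod_mul x v y w :
  T (x - sigma v) -> T (y - sigma w) -> T (x ** y - sigma (mul v w)).
Proof.
have [[subT TM] _ _] := fdT; move=> Tx Ty.
have Txy : T ((x - sigma v) ** y).
  rewrite -[y](subrK (sigma w)) linearDr /=.
  by apply: (subspaceD subT) (stT w Tx).2; apply: TM.
have -> : x ** y - sigma (mul v w)
    = (x - sigma v) ** y + sigma v ** (y - sigma w) + mul_defect v w.
  by rewrite linearBl linearBr /= !addrA !subrK.
by apply: (subspaceD subT) (modT v w); apply: (subspaceD subT) (stT v Ty).1.
Qed.

Lemma extension_subalg : is_subalg (extension T).
Proof.
have [[subT _] _ _] := fdT; split; first split.
- by exists 0; rewrite linear0 subr0; apply: subspace0.
- move=> x y [v Tx] [w Ty]; exists (v + w).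
  by rewrite linearD opprD addrACA; apply: subspaceD.
- move=> k x [v Tx]; exists (k *: v).
  by rewrite linearZ -scalerBr; apply: subspaceZ.
by move=> x y [v Tx] [w Ty]; exists (mul v w); apply: congr_mod_mul.
Qed.

Lemma extension_fin_dim : fin_dim (extension T).
Proof.
have [_ /fin_dim_coordinates[m [iota [_ TP]]] _] := fdT.
pose f (v : 'rV[K]_(n + m)) := sigma (lsubmx v) + iota (rsubmx v).
have linf : linear f by move=> k v w; rewrite /f !linearP scalerDr addrACA.
pose F : {linear 'rV[K]_(n + m) -> R} :=
  HB.pack f (GRing.isLinear.Build _ _ _ _ f linf).
apply: (fin_dim_range (f := F)) => x; split=> [[v /TP[w xE]]|[v ->]].
  by exists (row_mx v w); rewrite /= /f row_mxKl row_mxKr -xE addrC subrK.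
by exists (lsubmx v); apply/TP; exists (rsubmx v); rewrite /= /f addrC addKr.
Qed.

Lemma extension_fdss :
  (forall v, T (sigma v) -> v = 0) -> fdss_subalg (extension T).
Proof.
have [[subT _] _ _] := fdT; have algE := extension_subalg.
move=> injT; split=> //; first exact: extension_fin_dim.
apply: semiprime_semisimple => // x [v Tx] xEx0.
have T0 t : T (sigma t - sigma t) by rewrite subrr; apply: subspace0.
have v0 : v = 0.
  apply: sp => t; apply: injT; rewrite -[sigma _]opprK -[- sigma _]add0r.
  apply: subspaceN => //; rewrite -(xEx0 (sigma t)); last by exists t.
  exact: congr_mod_mul (congr_mod_mul Tx (T0 t)) Tx.
move: Tx; rewrite v0 linear0 subr0 => Tx.
apply: (fdss_semiprime fdT) => // t Tt.
by apply: xEx0; exists 0; rewrite linear0 subr0.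
Qed.

End Extension.

End MultiplicativeModulo.

(** * Stable semisimple subalgebras *)

Section GeneratedSubalgebra.
Variables (K : fieldType) (R : nalgType K) (X : seq R).
Local Notation "x ** y" := (nmul R x y) (at level 40, left associativity).

Definition generated (x : R) : Prop :=
  forall S, is_subalg S -> (forall y, y \in X -> S y) -> S x.

Lemma mem_generated x : x \in X -> generated x.
Proof. by move=> Xx S _; apply. Qed.

Lemma generated_subalg : is_subalg generated.
Proof.
split; first split.
- by move=> S [[]].
- move=> x y gx gy S algS XS; case: (algS) => subS _.
  by apply: subspaceD => //; [apply: gx | apply: gy].
- move=> k x gx S algS XS; case: (algS) => subS _.
  by apply: subspaceZ => //; apply: gx.
- move=> x y gx gy S algS XS; case: (algS) => _ SM.
  by apply: SM; [apply: gx | apply: gy].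
Qed.

Lemma generated_linear (f : {linear R -> R}) :
    (forall x y, f (x ** y) = f x ** y \/ f (x ** y) = x ** f y) ->
    (forall x, x \in X -> generated (f x)) ->
  forall x, generated x -> generated (f x).
Proof.
move=> fM fX x gx; have [gsub gM] := generated_subalg.
suff [] : generated x /\ generated (f x) by [].
apply: (gx (fun y => generated y /\ generated (f y))) => [|y Xy]; last first.
  by split; [apply: mem_generated | apply: fX].
split=> [|y z [gy gfy] [gz gfz]]; last first.
  by split; [apply: gM | case: (fM y z) => ->; apply: gM].
split=> [|y z [gy gfy] [gz gfz]|k y [gy gfy]].
- by rewrite linear0; split; apply: (subspace0 gsub).
- by rewrite linearD; split; apply: (subspaceD gsub).
- by rewrite linearZ; split; apply: (subspaceZ gsub).
Qed.

End GeneratedSubalgebra.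

Section StableHull.
Variables (K : fieldType) (R : nalgType K) (n : nat).
Variables (mul : {bilinear 'rV[K]_n -> 'rV[K]_n -> 'rV[K]_n}).
Variables (sigma : {linear 'rV[K]_n -> R}).
Implicit Types (x y : R) (X Y : seq R).
Local Notation "x ** y" := (nmul R x y) (at level 40, left associativity).

(* [None] stands for a formal unit. *)
Definition lmul_basis (i : option 'I_n) x : R :=
  if i is Some k then sigma 'e_k ** x else x.

Definition rmul_basis (j : option 'I_n) x : R :=
  if j is Some k then x ** sigma 'e_k else x.

Definition bimodule_hull Y : seq R :=
  [seq lmul_basis i x | i <- enum {: option 'I_n},
    x <- [seq rmul_basis j y | j <- enum {: option 'I_n}, y <- Y]].

Lemma bimodule_hullP Y x : reflect
  (exists i j y, y \in Y /\ x = lmul_basis i (rmul_basis j y))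
  (x \in bimodule_hull Y).
Proof.
apply: (iffP allpairsP) => [[[i z] [/= _ /allpairsP[[j y] [/= _ Yy ->]] ->]]|].
  by exists i, j, y.
move=> [i [j [y [Yy ->]]]]; exists (i, rmul_basis j y); split=> //=.
  by rewrite mem_enum.
by apply: allpairs_f; rewrite ?mem_enum.
Qed.

Lemma lmul_basis_mul i x y : lmul_basis i x ** y = lmul_basis i (x ** y).
Proof. by case: i => //= k; rewrite nmulA. Qed.

Lemma bimodule_hull_stable Y :
    (forall k l, mul_defect mul sigma 'e_k 'e_l \in Y) ->
  stable_under sigma (generated (bimodule_hull Y)).
Proof.
move=> defY; set X := bimodule_hull Y; have [subX XM] := generated_subalg X.
have gen i j y : y \in Y -> generated X (lmul_basis i (rmul_basis j y)).
  by move=> Yy; apply: mem_generated; apply/bimodule_hullP; exists i, j, y.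
have gen_def k l : generated X (mul_defect mul sigma 'e_k 'e_l).
  exact: gen None None _ (defY k l).
have sigmaM k l : sigma 'e_k ** sigma 'e_l
    = sigma (mul 'e_k 'e_l) + mul_defect mul sigma 'e_k 'e_l.
  by rewrite addrC subrK.
apply: stable_under_basis => // k x gx; split.
  apply: (generated_linear (f := nmul R (sigma 'e_k))) gx => [y z|].
    by left; apply: nmulA.
  move=> _ /bimodule_hullP[[l|] [j [y [Yy ->]]]]; last exact: (gen (Some k)).
  rewrite /= nmulA sigmaM linearDl; apply: (subspaceD subX).
    apply: (subspace_linear_rV subX
      (f := applyr (nmul R) (rmul_basis j y) \o sigma)) => m.
    exact: (gen (Some m)).
  exact: XM (gen_def k l) (gen None j y Yy).
apply: (generated_linear (f := applyr (nmul R) (sigma 'e_k))) gx => [y z|].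
  by right; rewrite /= /applyr_head nmulA.
move=> _ /bimodule_hullP[i [[l|] [y [Yy ->]]]]; rewrite /= /applyr_head.
  rewrite lmul_basis_mul -nmulA sigmaM -lmul_basis_mul linearDr.
  apply: (subspaceD subX); last exact: XM (gen i None y Yy) (gen_def l k).
  apply: (subspace_linear_rV subX (f := nmul R (lmul_basis i y) \o sigma)) => m.
  by rewrite /= lmul_basis_mul; apply: (gen i (Some m)).
by rewrite lmul_basis_mul; apply: (gen i (Some k)).
Qed.

Lemma exists_stable_generators (J : R -> Prop) (F : seq R) :
    is_ideal J -> multiplicative_mod mul sigma J ->
    (forall x, x \in F -> J x) ->
  exists X, [/\ forall x, x \in X -> J x,
    forall x, x \in F -> generated X x,
    stable_under sigma (generated X)
    & multiplicative_mod mul sigma (generated X)].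
Proof.
move=> [_ _ Jl Jr] modJ FJ.
pose Y := F ++
  [seq mul_defect mul sigma 'e_k 'e_l | k <- enum 'I_n, l <- enum 'I_n].
have defY k l : mul_defect mul sigma 'e_k 'e_l \in Y.
  by rewrite mem_cat; apply/orP; right; apply: allpairs_f; rewrite mem_enum.
have YJ y : y \in Y -> J y.
  by rewrite mem_cat => /orP[/FJ //|/allpairsP[[k l] [_ _ ->]]]; apply: modJ.
have genY y : y \in Y -> generated (bimodule_hull Y) y.
  move=> Yy; apply: mem_generated; apply/bimodule_hullP.
  by exists None, None, y.
exists (bimodule_hull Y); split=> [x|x Fx||].
- move=> /bimodule_hullP[i [j [y [/YJ Jy ->]]]].
  have Jyr : J (rmul_basis j y) by case: j => //= l; apply: Jr.
  by case: i => //= k; apply: Jl.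
- by apply: genY; rewrite mem_cat Fx.
- exact: bimodule_hull_stable.
apply: multiplicative_mod_basis => [|k l]; last by apply: genY; apply: defY.
by case: (generated_subalg (bimodule_hull Y)).
Qed.

Lemma exists_stable_fdss (J : R -> Prop) (F : seq R) :
    perfect_field K -> associative mul -> semiprime mul ->
    is_ideal J -> locally_fdss_in J -> multiplicative_mod mul sigma J ->
    (forall x, x \in F -> extension sigma J x) ->
  exists T, [/\ fdss_subalg T /\ (forall x, T x -> J x),
    forall x, x \in F -> extension sigma T x,
    stable_under sigma T & multiplicative_mod mul sigma T].
Proof.
move=> perfK mulA sp idJ lfJ modJ FJ; have [_ _ Jl _] := idJ.
have [x /FJ[v Jxv]|D [DJ FD]] := @exists_seq_image _ _
    (fun x y => J y /\ exists v, y = x - sigma v) F.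
  by exists (x - sigma v); split; last exists v.
have [y /DJ[x []] //|X [XJ genD stN modN]] :=
  exists_stable_generators (F := D) idJ modJ.
have [S [fdS SJ XS]] := lfJ X XJ; have [algS _ _] := fdS.
have [e Se eS] := fdss_unit fdS.
have [|q [Jq qN qC]] :=
    exists_commuting_local_unit mulA sp perfK idJ (SJ e Se) stN modN.
  by move=> x Nx; apply: eS; apply: Nx.
have [|T [fdT TJ XT]] :=
    lfJ (q :: [seq sigma 'e_i ** q | i <- enum 'I_n] ++ X).
  move=> x; rewrite inE mem_cat => /or3P[/eqP->|/mapP[i _ ->]|/XJ] //.
  exact: Jl.
have [algT _ _] := fdT; have [subT _] := algT.
have Tq : T q by apply: XT; rewrite mem_head.
have Tsq a : T (sigma a ** q).
  apply: (subspace_linear_rV subT (f := applyr (nmul R) q \o sigma)) => i.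
  by apply: XT; rewrite inE mem_cat; apply/or3P/Or32/mapP; exists i;
    rewrite ?mem_enum.
have [k [fdC cornerS]] := fdss_corner fdT Tq.
have NC x : generated X x -> corner T q k x.
  move=> Nx; have [qx xq] := qN x Nx.
  exists x; last by rewrite iter_fix // /compress xq.
  by apply: Nx => // y Xy; apply: XT; rewrite inE mem_cat Xy !orbT.
exists (corner T q k); split=> [|x /FD[y Dy [_ [v yE]]]||a b].
- by split=> // _ [t Tt ->]; apply: TJ; apply: subalg_iter_compress.
- by exists v; rewrite -yE; apply: NC; apply: genD.
- exact: corner_stable.
- by apply: NC; apply: modN.
Qed.

End StableHull.

Unset Implicit Arguments.

Theorem theorem4p6 (K : fieldType) (R : nalgType K) (J : R -> Prop)
    (Q : nalgType K) (pi : R -> Q) :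
  perfect_field K ->
  is_ideal J ->
  nalg_hom pi ->
  (forall q : Q, exists r : R, pi r = q) ->
  (forall r : R, pi r = 0 <-> J r) ->
  locally_fdss_in J ->
  locally_fdss Q ->
  locally_fdss R.
Proof.
move=> perfK idJ [piD piZ piM] pi_surj piJ lfJ lfQ F _.
have pi_linear : linear pi by move=> k x y; rewrite piD piZ.
pose p : {linear R -> Q} :=
  HB.pack pi (GRing.isLinear.Build _ _ _ _ pi pi_linear).
have piB : {morph pi : x y / x - y} := linearB p.
have [S [fdS _ FS]] := lfQ [seq pi x | x <- F] (fun _ _ => I).
have [n [mul [iota [mulA sp [iota_inj SP iotaM]]]]] := fdss_coordinates fdS.
have [sigma sigmaE] :
  exists g : {linear 'rV_n -> R}, forall v, pi (g v) = iota v.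
  exact: (linear_lift (p := p)).
have modJ : multiplicative_mod mul sigma J.
  by move=> a b; apply/piJ; rewrite piB piM !sigmaE iotaM subrr.
have FJ x : x \in F -> extension sigma J x.
  move=> /(map_f pi)/FS/SP[v xv]; exists v.
  by apply/piJ; rewrite piB sigmaE xv subrr.
have [T [[fdT TJ] FT stT modT]] :=
  exists_stable_fdss perfK mulA sp idJ lfJ modJ FJ.
exists (extension sigma T); split=> //.
apply: (extension_fdss sp fdT stT modT) => v /TJ/piJ piv0.
by apply: iota_inj; rewrite -sigmaE piv0 linear0.
Qed.
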